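(* Suppose there is an isometric embedding of a graph $G$ into $S^n$, for some $n\geq 2$. Then one of the following holds: (a) $G$ is the graph $\{\{v_1,v_2\},\{v_2,v_3\},\ldots,\{v_{m-1},v_m\}\}$ for some $m\geq 1$; (b) $G$ is the graph $\{\{v_1,v_2\},\{v_2,v_3\},\ldots,\{v_{m-1},v_m\},\{v_1,v_m\}\}$ for some $m\geq 3$; (c) $G$ is a complete graph with the number of vertices smaller than or equal to $n+2$; (d) $G$ is (isomorphic to) a subgraph of the graph $G_n$.
   Context: A graph $G=(V(G),E(G))$ is a pair of sets such that the elements of $E(G)$ (edges) are $2$-element subsets of $V(G)$ (the set of vertices). $G$ is complete if each pair of distinct vertices is an edge. $G_1$ is a subgraph of $G_2$ if $V(G_1)\subseteq V(G_2)$ and $E(G_1)\subseteq E(G_2)$. In (a) and (b) the graph is described by its list of edges; its vertices are the distinct vertices $v_1,\ldots,v_m$ (so (a) is the path on $m$ vertices, which for $m=1$ is a single vertex with no edges, and (b) is the cycle on $m$ vertices). A path of length $k$ from $x$ to $y$ (for distinct $x,y\in V(G)$) is a sequence of edges $\sigma_1\sigma_2\ldots\sigma_k$ with $\sigma_i=\{v_{i-1},v_i\}$, $v_0=x$, $v_k=y$, and $v_0,\ldots,v_k$ distinct. The distance $d_G(x,y)$ is the length of a shortest path in $G$ from $x$ to $y$; $d_G(x,y)=\infty$ if there is no such path, and $d_G(x,x)=0$. $S^n$ denotes the round $n$-sphere in $\mathbb{R}^{n+1}$ of some (arbitrary) radius $r>0$ with its Riemannian metric, and $d_{S^n}(p,q)$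 is the geodesic distance, i.e. the length of a shortest geodesic on $S^n$ from $p$ to $q$. An isometric embedding of $G$ into $S^n$ is an injective map $f:V(G)\to S^n$ such that $d_G(x,y)=d_{S^n}(f(x),f(y))$ for all $x,y\in V(G)$. The graph $G_n$: its vertex set is the set of $2n+2$ points $$V=\{(\pm\tfrac{2}{\pi},0,\ldots,0),(0,\pm\tfrac{2}{\pi},0,\ldots,0),\ldots,(0,\ldots,0,\pm\tfrac{2}{\pi})\}\subset\mathbb{R}^{n+1},$$ and for $a,b\in V$, $\{a,b\}$ is an edge if and only if $\langle a,b\rangle=0$ for the canonical inner product of $\mathbb{R}^{n+1}$ (equivalently, distinct $a,b$ form an edge if and only if they are not antipodal). *)

(* Defs.v *)
From HB Require Import structures.
From mathcomp Require Import all_boot all_order all_algebra.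
From mathcomp Require Import all_classical all_reals all_analysis.

Set Implicit Arguments.
Unset Strict Implicit.
Unset Printing Implicit Defensive.

Import Order.TTheory GRing.Theory Num.Theory.
Import numFieldNormedType.Exports.

Local Open Scope classical_set_scope.
Local Open Scope ring_scope.

(** * Graphs *)

(* A graph with vertices in the ambient type [T]; no finiteness is assumed. *)
Record graph (T : Type) := Graph {
  vertices : set T;
  edges : set (set T);
  edges_subset2 : forall e, edges e ->
    exists x y, [/\ vertices x, vertices y, x <> y & e = [set x; y]]
}.

Definition subgraph (T : Type) (G H : graph T) : Prop :=
  vertices G `<=` vertices H /\ edges G `<=` edges H.

Definition isomorphic (T U : Type) (G : graph T) (H : graph U) : Prop :=
  exists2 f : T -> U, set_bij (vertices G) (vertices H) f &
    forall x y, vertices G x -> vertices G y ->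
      (edges G [set x; y] <-> edges H [set f x; f y]).

Definition complete (T : Type) (G : graph T) : Prop :=
  forall x y, vertices G x -> vertices G y -> x <> y -> edges G [set x; y].

(* Only v 0, ..., v k matter. As they are distinct, there is a path from x to x
   of length k only for k = 0. *)
Definition path_of_length (T : Type) (G : graph T) (x y : T) (k : nat) : Prop :=
  exists v : nat -> T, [/\ v 0%N = x, v k = y,
    set_inj [set i | (i <= k)%N] v &
    forall i, (i < k)%N -> edges G [set v i; v i.+1]].

(* The infimum of the empty set is +oo; by the previous remark,
   the distance from x to x is 0. *)
Definition graph_dist (R : realType) (T : Type) (G : graph T) (x y : T) :
    \bar R :=
  ereal_inf [set (k%:R)%:E | k in path_of_length G x y].

(* G has the distinct vertices v 1, ..., v m, and the edges
   {v 1, v 2}, ..., {v (m-1), v m}. *)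
Definition is_path_graph (T : Type) (G : graph T) (m : nat) : Prop :=
  exists v : nat -> T, [/\ set_inj [set i | (1 <= i <= m)%N] v,
    vertices G = v @` [set i | (1 <= i <= m)%N] &
    edges G = [set [set v i; v i.+1] | i in [set i | (1 <= i < m)%N]]].

Definition is_cycle_graph (T : Type) (G : graph T) (m : nat) : Prop :=
  exists v : nat -> T, [/\ set_inj [set i | (1 <= i <= m)%N] v,
    vertices G = v @` [set i | (1 <= i <= m)%N] &
    edges G = [set [set v i; v i.+1] | i in [set i | (1 <= i < m)%N]]
              `|` [set [set v 1%N; v m]]].

(** * The round sphere *)

(* The library norm on row vectors is the sup norm, hence [enorm]. *)
Definition dot (R : realType) (d : nat) (u v : 'rV[R]_d) : R :=
  \sum_(i < d) u 0 i * v 0 i.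

Definition enorm (R : realType) (d : nat) (u : 'rV[R]_d) : R :=
  Num.sqrt (dot u u).

Definition sphere (R : realType) (n : nat) (r : R) : set 'rV[R]_n.+1 :=
  [set p | enorm p = r].

(* [c] restricted to [a, b] is a (possibly constant) geodesic of the sphere of
   radius r: it stays on the sphere and its covariant derivative vanishes.
   The Levi-Civita connection of a submanifold of R^(n+1) is the tangential
   part of the ambient derivative, so the last clause says that the
   acceleration is orthogonal to the tangent space {w | <w, c t> = 0}.
   Smoothness follows from the equation. *)
Definition geodesic (R : realType) (n : nat) (r : R)
    (a b : R) (c : R -> 'rV[R]_n.+1) : Prop :=
  forall t, a <= t <= b ->
    [/\ sphere r (c t), derivable c t 1, derivable (derive1 c) t 1 &
        forall w, dot w (c t) = 0 -> dot w (derive1 (derive1 c) t) = 0].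

Definition curve_length (R : realType) (n : nat)
    (a b : R) (c : R -> 'rV[R]_n.+1) : \bar R :=
  (\int[lebesgue_measure]_(t in `[a, b]) (enorm (derive1 c t))%:E)%E.

(* The infimum is attained for p, q on the sphere. *)
Definition sphere_dist (R : realType) (n : nat) (r : R)
    (p q : 'rV[R]_n.+1) : \bar R :=
  ereal_inf [set l | exists (a b : R) (c : R -> 'rV[R]_n.+1),
    [/\ a <= b, geodesic r a b c, c a = p, c b = q & l = curve_length a b c]].

Definition isometric_embedding (R : realType) (T : Type) (G : graph T)
    (n : nat) (r : R) (f : T -> 'rV[R]_n.+1) : Prop :=
  [/\ set_fun (vertices G) (sphere r) f, set_inj (vertices G) f &
      forall x y, vertices G x -> vertices G y ->
        graph_dist R G x y = sphere_dist r (f x) (f y)].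

(** * The graph G_n *)

Definition Gn_vertices (R : realType) (n : nat) : set 'rV[R]_n.+1 :=
  [set v | exists i : 'I_n.+1,
    v = (2 / pi) *: delta_mx 0 i \/ v = (- (2 / pi)) *: delta_mx 0 i].

Definition Gn_edges (R : realType) (n : nat) : set (set 'rV[R]_n.+1) :=
  [set e | exists a b, [/\ Gn_vertices a, Gn_vertices b, dot a b = 0 &
    e = [set a; b]]].

Lemma Gn_vertex_dot_neq0 (R : realType) (n : nat) (a : 'rV[R]_n.+1) :
  Gn_vertices a -> dot a a <> 0.
Proof.
have pi_neq0 : (2 / pi : R) != 0 by rewrite gt_eqF// divr_gt0// pi_gt0.
have dotZ (s : R) i : dot (s *: delta_mx 0 i : 'rV[R]_n.+1)
                          (s *: delta_mx 0 i) = s ^+ 2.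
  rewrite /dot (bigD1 i)//= big1 => [|j ji]; last first.
    by rewrite !mxE (negbTE ji) andbF mulr0 mul0r.
  by rewrite !mxE !eqxx mulr1 addr0 expr2.
by move=> [i [->|->]]; rewrite dotZ => /eqP; rewrite sqrf_eq0 ?oppr_eq0;
  apply/negP.
Qed.

Lemma Gn_edges_subset2 (R : realType) (n : nat) (e : set 'rV[R]_n.+1) :
  Gn_edges e ->
  exists x y, [/\ Gn_vertices x, Gn_vertices y, x <> y & e = [set x; y]].
Proof.
move=> [a [b [Va Vb ab ->]]]; exists a, b; split=> // eq_ab.
by move: ab; rewrite -eq_ab; exact: Gn_vertex_dot_neq0.
Qed.

Definition Gn (R : realType) (n : nat) : graph 'rV[R]_n.+1 :=
  Graph (@Gn_edges_subset2 R n).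

(* Main.v *)
Require Import Defs.
From HB Require Import structures.
From mathcomp Require Import all_boot all_order all_algebra.
From mathcomp Require Import all_classical all_reals all_analysis.
From mathcomp Require Import zify ring lra.

Set Implicit Arguments.
Unset Strict Implicit.
Unset Printing Implicit Defensive.

Import Order.TTheory GRing.Theory Num.Theory.
Import numFieldNormedType.Exports.

Local Open Scope classical_set_scope.
Local Open Scope ring_scope.

(** The geodesic distance of the sphere of radius r is r * acos (<p, q> / r^2)
    [sphere_distE]: along a geodesic c starting at p the speed s is constant and
    <p, c> satisfies g'' = - (s / r)^2 g, hence
    <p, c t> = r^2 cos (s (t - a) / r) [geodesic_length], and great circles
    realize the distance.  Adjacent vertices of G are thus mapped to vectors with
    inner product r^2 cos (1 / r), and if x and y are distinct, not adjacent, and have a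
    common neighbour z, then their distance is 2 and
      f x + f y = 2 cos (1 / r) f z        [embedding_midpoint],
    because the difference of the two sides has norm 0.

    If G is complete, f embeds it as an equidistant set of R^(n+1), so it has
    at most n + 2 vertices.  Otherwise G, being connected, has vertices at
    distance 2, so 2 / r <= pi.

    If 2 / r < pi, then cos (1 / r) > 0, and the identity above determines each
    of x, y, z from the other two.  So a vertex z with two nonadjacent
    neighbours x and y has no other neighbour w: if w is not adjacent to x, then
    w = y since z is the midpoint both of x, w and of x, y; similarly for y; and
    if w is adjacent to both, it is the midpoint of x, y, so w = z
    [midpoint_degree2].  By connectedness this local property spreads:
    G has no triangle, hence all degrees are at most 2 [degree_le2].  A
    connected graph of bounded diameter with degrees at most 2 is a path or a
    cycle [path_or_cycle].

    If 2 / r = pi, then adjacent vertices are orthogonal and all other pairs of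
    distinct vertices antipodal.  Pairwise orthogonal vertices are at most
    n + 1, so they can be sent to distinct coordinate axes, which identifies G
    with an induced subgraph of G_n [subgraph_of_Gn]. *)

(** * The Euclidean inner product *)

Section Dot.
Variables (R : realType) (d : nat).
Implicit Types (u v w : 'rV[R]_d) (a : R).

Lemma dotC u v : dot u v = dot v u.
Proof. by apply: eq_bigr => i _; rewrite mulrC. Qed.

Lemma dotDl u v w : dot (u + v) w = dot u w + dot v w.
Proof. by rewrite -big_split; apply: eq_bigr => i _; rewrite mxE mulrDl. Qed.

Lemma dotZl a u v : dot (a *: u) v = a * dot u v.
Proof. by rewrite mulr_sumr; apply: eq_bigr => i _; rewrite mxE mulrA. Qed.

Lemma dotNl u v : dot (- u) v = - dot u v.
Proof. by rewrite -scaleN1r dotZl mulN1r. Qed.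

Lemma dotDr u v w : dot w (u + v) = dot w u + dot w v.
Proof. by rewrite dotC dotDl !(dotC w). Qed.

Lemma dotZr a u v : dot v (a *: u) = a * dot v u.
Proof. by rewrite dotC dotZl dotC. Qed.

Lemma dotNr u v : dot v (- u) = - dot v u.
Proof. by rewrite dotC dotNl dotC. Qed.

Lemma dot0r u : dot u 0 = 0.
Proof. by rewrite -(scale0r 0) dotZr mul0r. Qed.

Lemma dot_ge0 u : 0 <= dot u u.
Proof. by apply: sumr_ge0 => i _; rewrite -expr2 sqr_ge0. Qed.

Lemma dot_eq0 u : dot u u = 0 -> u = 0.
Proof.
move=> u0; apply/rowP => i; rewrite mxE; apply/eqP; rewrite -sqrf_eq0 expr2.
by have/psumr_eq0P -> // := u0; move=> j _; rewrite -expr2 sqr_ge0.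
Qed.

End Dot.

Definition dotE := (dotDl, dotDr, dotNl, dotNr, dotZl, dotZr).

(** * The geodesic distance of the sphere *)

Section Geodesics.
Variables (R : realType) (n : nat).
Implicit Types (p q u : 'rV[R]_n.+1) (c : R -> 'rV[R]_n.+1) (r a b t : R).

Lemma sphere_dot r p : 0 < r -> sphere r p <-> dot p p = r ^+ 2.
Proof.
move=> r0; split=> [<-|pp]; first by rewrite sqr_sqrtr// dot_ge0.
by rewrite /sphere/= /enorm pp sqrtr_sqr gtr0_norm.
Qed.

Lemma is_derive_dot (c e : R -> 'rV[R]_n.+1) (dc de : 'rV[R]_n.+1) t :
  is_derive t 1 c dc -> is_derive t 1 e de ->
  is_derive t 1 (fun x => dot (c x) (e x)) (dot dc (e t) + dot (c t) de).
Proof.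
have coord (k : R -> 'rV[R]_n.+1) (dk : 'rV[R]_n.+1) i : is_derive t 1 k dk ->
    is_derive t 1 (fun x => k x 0 i) (dk 0 i).
  move=> [k_drv <-]; apply: DeriveDef.
    exact: (derivable_mxP _ _ _).1 k_drv 0 i.
  by rewrite derive_mx// mxE.
move=> c_dc e_de.
have -> : (fun x => dot (c x) (e x)) =
    \sum_(i < n.+1) ((fun x => c x 0 i) * (fun x => e x 0 i)).
  by apply/funext => x; rewrite fct_sumE.
have di i := is_deriveM (coord _ _ i c_dc) (coord _ _ i e_de).
apply: is_derive_eq; rewrite /dot -big_split/=; apply: eq_bigr => i _.
by rewrite addrC /GRing.scale/= [e t 0 i * _]mulrC.
Qed.

Lemma derive0_cst (f : R -> R) a b : a <= b ->
  (forall t, a <= t <= b -> derivable f t 1) ->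
  (forall t, a < t < b -> is_derive t 1 f 0) -> f b = f a.
Proof.
move=> ab df f0; apply/eqP; rewrite -subr_eq0.
have fc : {within `[a, b], continuous f}.
  by apply: derivable_within_continuous => x; rewrite in_itv; exact: df.
have dfe x : x \in `]a, b[ -> is_derive x 1 f ((fun=> 0) x).
  by rewrite in_itv; exact: f0.
by have [c _ ->] := MVT_segment ab dfe fc; rewrite mul0r.
Qed.

Lemma locally_cst_is_derive (f : R -> R) a b k t :
  (forall x, a < x < b -> f x = k) -> a < t < b -> is_derive t 1 f 0.
Proof.
move=> fk tab; have cst0 := is_derive_cst (k : R) t (1 : R).
apply: (near_eq_is_derive _ cst0).
have : t \in `]a, b[ by rewrite in_itv.
by move/near_in_itvoo; apply: filterS => x; rewrite in_itv => /fk ->.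
Qed.

(** The continuity argument which transfers an equation from the interior of an
    interval to its end points. *)
Lemma cst_ooW (f : R -> R) a b k : a < b ->
  (forall t, a <= t <= b -> derivable f t 1) ->
  (forall t, a < t < b -> f t = k) -> forall t, a <= t <= b -> f t = k.
Proof.
move=> ab df fk.
have f0 x : a < x < b -> is_derive x 1 f 0 := locally_cst_is_derive fk.
have cst_a t : a <= t <= b -> f t = f a.
  move=> /andP[at_ tb]; apply: derive0_cst => // x /andP[ax xt].
    by apply: df; rewrite ax (le_trans xt).
  by apply: f0; rewrite ax (lt_le_trans xt).
have mid : a < (a + b) / 2 < b by have := mid_in_itvoo ab; rewrite in_itv.
move=> t /cst_a ->; rewrite -(fk _ mid) cst_a//.
by case/andP: mid => /ltW -> /ltW ->.
Qed.

(** The equation g'' = - w^2 g is integrated without any uniqueness theorem: if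
    (w g, g') is turned by the angle w (t - a), the result is constant. *)
Lemma harmonic_motion (g g1 : R -> R) (a b w : R) : a <= b -> w != 0 ->
  (forall t, a <= t <= b -> is_derive t 1 g (g1 t)) ->
  (forall t, a <= t <= b -> derivable g1 t 1) ->
  (forall t, a < t < b -> is_derive t 1 g1 (- (w ^+ 2 * g t))) ->
  g1 a = 0 -> g b = g a * cos (w * (b - a)).
Proof.
move=> ab w0 dg dg1 dg2 g1a.
pose C t := cos (w * (t - a)); pose S t := sin (w * (t - a)).
have dlin t : is_derive t 1 (fun x => w * (x - a)) w.
  have dsub := is_deriveB (is_derive_id t (1 : R)) (is_derive_cst a t 1).
  have := is_deriveZ w dsub.
  by rewrite subr0 /GRing.scale/= mulr1.
have dC t : is_derive t 1 C (- (w * S t)).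
  by rewrite mulrC -mulNr; apply: (is_derive1_comp (f := cos)).
have dS t : is_derive t 1 S (w * C t).
  by rewrite mulrC; apply: (is_derive1_comp (f := sin)).
(* The coordinates of the turned vector. *)
pose F := (w \*: g) * C - g1 * S; pose H := (w \*: g) * S + g1 * C.
have dF t d : is_derive t 1 g (g1 t) -> is_derive t 1 g1 d ->
    is_derive t 1 F (- (w ^+ 2 * g t + d) * S t).
  move=> gt g1t.
  have d1 := is_deriveM (is_deriveZ w gt) (dC t).
  apply: (is_derive_eq (is_deriveB d1 (is_deriveM g1t (dS t)))).
  by rewrite /GRing.scale/= -[w *: g t]/(w * g t); ring.
have dH t d : is_derive t 1 g (g1 t) -> is_derive t 1 g1 d ->
    is_derive t 1 H ((w ^+ 2 * g t + d) * C t).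
  move=> gt g1t.
  have d1 := is_deriveM (is_deriveZ w gt) (dS t).
  apply: (is_derive_eq (is_deriveD d1 (is_deriveM g1t (dC t)))).
  by rewrite /GRing.scale/= -[w *: g t]/(w * g t); ring.
have oo_cc t : a < t < b -> a <= t <= b by case/andP => /ltW -> /ltW ->.
have drv t : a <= t <= b -> is_derive t 1 g1 ('D_1 g1 t).
  by move=> tab; apply: DeriveDef => //; exact: dg1.
have h : F b = F a.
  apply: (derive0_cst ab) => t tab.
    by have [] := dF _ _ (dg _ tab) (drv _ tab).
  by have := dF _ _ (dg _ (oo_cc _ tab)) (dg2 _ tab); rewrite subrr oppr0 mul0r.
have k : H b = H a.
  apply: (derive0_cst (f := H) ab) => t tab.
    by have [] := dH _ _ (dg _ tab) (drv _ tab).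
  by have := dH _ _ (dg _ (oo_cc _ tab)) (dg2 _ tab); rewrite subrr mul0r.
have CS : C b ^+ 2 + S b ^+ 2 = 1 := cos2Dsin2 (w * (b - a)).
have {}h : w * g b * C b - g1 b * S b = w * g a.
  have := h; rewrite /F /C /S /= !fctE g1a subrr mulr0 cos0 sin0.
  by rewrite mulr1 mulr0 subr0.
have {}k : w * g b * S b + g1 b * C b = 0.
  have := k; rewrite /H /C /S /= !fctE g1a subrr mulr0 cos0 sin0.
  by rewrite mulr0 mul0r addr0.
apply: (mulfI w0); rewrite -/(C b).
rewrite -[LHS]mulr1 -CS mulrA -h.
have -> : w * g b * (C b ^+ 2 + S b ^+ 2) =
    (w * g b * C b - g1 b * S b) * C b + (w * g b * S b + g1 b * C b) * S b.
  by ring.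
by rewrite k mul0r addr0.
Qed.

(** Since <c, c> is constant, c' is orthogonal to c; so it is a tangent vector,
    hence orthogonal to c'', and <c', c'> is constant.  The last clause says that
    c'' = - (s / r)^2 c: its tangential part vanishes, and differentiating
    <c, c'> = 0 gives <c, c''> = - <c', c'>.  As c is on the sphere only for times
    in [a, b], <c, c'> need not vanish on both sides of a and b, hence the
    restriction to the interior. *)
Lemma geodesic_speed r a b c : 0 < r -> a < b -> geodesic r a b c ->
  exists2 s, 0 <= s & forall t, a <= t <= b ->
  [/\ dot (c t) (derive1 c t) = 0, enorm (derive1 c t) = s &
      a < t < b -> forall p,
        dot p (derive1 (derive1 c) t) = - ((s / r) ^+ 2 * dot p (c t))].
Proof.
move=> r0 ab geo.
have oo_cc t : a < t < b -> a <= t <= b by case/andP => /ltW -> /ltW ->.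
have cc t : a <= t <= b -> dot (c t) (c t) = r ^+ 2.
  by move=> /geo[] /sphere_dot ->.
have dc t : a <= t <= b -> is_derive t 1 c (derive1 c t).
  by move=> /geo[_ ? _ _]; apply: DeriveDef; rewrite ?derive1E.
have ddc t : a <= t <= b -> is_derive t 1 (derive1 c) (derive1 (derive1 c) t).
  by move=> /geo[_ _ ? _]; apply: DeriveDef; rewrite ?derive1E.
set v := derive1 c in dc ddc *; set acc := derive1 v in ddc *.
have cv t : a <= t <= b -> dot (c t) (v t) = 0.
  apply: (cst_ooW ab (f := fun x => dot (c x) (v x))) => {}t tab.
    by have [] := is_derive_dot (dc _ tab) (ddc _ tab).
  have [_ dcc] := is_derive_dot (dc _ (oo_cc _ tab)) (dc _ (oo_cc _ tab)).
  have k x : a < x < b -> dot (c x) (c x) = r ^+ 2 by move/oo_cc/cc.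
  have [_ dcc0] := locally_cst_is_derive k tab.
  by move: dcc; rewrite dcc0 (dotC (v t)) => ?; lra.
have va t : a <= t <= b -> dot (v t) (acc t) = 0.
  by move=> tab; have [_ _ _] := geo _ tab; apply; rewrite dotC cv.
have vv t : a <= t <= b -> dot (v t) (v t) = dot (v a) (v a).
  move=> /andP[at_ tb].
  have sub x : a <= x <= t -> a <= x <= b.
    by move=> /andP[-> /le_trans]; exact.
  apply: (derive0_cst (f := fun x => dot (v x) (v x))) => // x xat.
    by have /sub /ddc dx := xat; have [] := is_derive_dot dx dx.
  have /sub xab : a <= x <= t by case/andP: xat => /ltW -> /ltW ->.
  have := is_derive_dot (ddc _ xab) (ddc _ xab).
  by rewrite dotC va// addr0.
exists (enorm (v a)) => [|t tab]; first exact: sqrtr_ge0.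
split; [exact: cv | by rewrite /enorm vv | move=> tab' p].
have ca : dot (c t) (acc t) = - dot (v t) (v t).
  have [_ dcv] := is_derive_dot (dc _ tab) (ddc _ tab).
  have k x : a < x < b -> dot (c x) (v x) = 0 by move/oo_cc/cv.
  have [_ dcv0] := locally_cst_is_derive k tab'.
  by move: dcv; rewrite dcv0 => ?; lra.
(* The tangential part of p at c t. *)
have [_ _ _ /(_ (p - (dot p (c t) / r ^+ 2) *: c t))] := geo _ tab.
rewrite !dotE cc// divfK ?subrr ?sqrf_eq0 ?gt_eqF// => /(_ erefl).
rewrite -/v -/acc ca vv// => /eqP; rewrite mulrN opprK addr_eq0 => /eqP ->.
by rewrite expr_div_n sqr_sqrtr ?dot_ge0//; field; rewrite gt_eqF.
Qed.

(** For p := c a, harmonic_motion applies to <p, c>, whose derivative at a is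
    <c a, c' a> = 0. *)
Lemma geodesic_length r a b c : 0 < r -> a <= b -> geodesic r a b c ->
  exists L, [/\ 0 <= L, curve_length a b c = L%:E &
    dot (c a) (c b) = r ^+ 2 * cos (L / r)].
Proof.
move=> r0; rewrite le_eqVlt => /orP[/eqP <-|ab] geo.
  exists 0; split=> //; last first.
    rewrite mul0r cos0 mulr1; apply/sphere_dot => //.
    by have [] := geo a; rewrite ?lexx.
  by rewrite /curve_length set_itv1 integral_set1.
have [s s0 speed] := geodesic_speed r0 ab geo.
exists (s * (b - a)); split.
- by rewrite mulr_ge0// subr_ge0 ltW.
- rewrite /curve_length (eq_integral (cst s%:E)); last first.
    by move=> t; rewrite inE/= in_itv => /speed[_ ->].
  rewrite integral_cst//= lebesgue_measure_itv/= lte_fin ab.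
  by rewrite -EFinB -EFinM.
have aab : a <= a <= b by rewrite lexx ltW.
have bab : a <= b <= b by rewrite lexx ltW.
have caca : dot (c a) (c a) = r ^+ 2 by apply/sphere_dot => //; case: (geo a aab).
have dp (k : R -> 'rV[R]_n.+1) dk t : is_derive t 1 k dk ->
    is_derive t 1 (fun x => dot (c a) (k x)) (dot (c a) dk).
  move=> kdk; have := is_derive_dot (is_derive_cst (c a) t (1 : R)) kdk.
  by rewrite dotC dot0r add0r.
have dc t : a <= t <= b -> is_derive t 1 c (derive1 c t).
  by move=> /geo[_ ? _ _]; apply: DeriveDef; rewrite ?derive1E.
have ddc t : a <= t <= b -> is_derive t 1 (derive1 c) (derive1 (derive1 c) t).
  by move=> /geo[_ _ ? _]; apply: DeriveDef; rewrite ?derive1E.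
(* At speed 0 the frequency s / r is 0 and c is constant. *)
have [s_eq0|s_neq0] := eqVneq s 0.
  rewrite s_eq0 !mul0r cos0 mulr1 -caca.
  apply: (derive0_cst (f := fun t => dot (c a) (c t)) (ltW ab)) => t tab.
    by have [] := dp _ _ _ (dc _ tab).
  have tab' : a <= t <= b by case/andP: tab => /ltW -> /ltW ->.
  have := dp _ _ _ (dc _ tab').
  suff -> : derive1 c t = 0 by rewrite dot0r.
  have [_ + _] := speed _ tab'; rewrite s_eq0 => /eqP.
  by rewrite sqrtr_eq0 => v0; apply: dot_eq0; apply/eqP; rewrite eq_le v0 dot_ge0.
rewrite -caca mulrAC.
apply: (harmonic_motion (g := fun t => dot (c a) (c t))
  (g1 := fun t => dot (c a) (derive1 c t)) (ltW ab)).
- by rewrite mulf_neq0// invr_eq0 gt_eqF.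
- by move=> t tab; apply: dp; exact: dc.
- by move=> t tab; have [] := dp _ _ _ (ddc _ tab).
- move=> t tab; have tab' : a <= t <= b by case/andP: tab => /ltW -> /ltW ->.
  have [_ _ /(_ tab (c a)) <-] := speed _ tab'; exact: dp (ddc _ tab').
- by have [] := speed _ aab.
Qed.

End Geodesics.

Lemma exists_left_kernel (F : fieldType) m k (M : 'M[F]_(m, k)) : (k < m)%N ->
  exists2 v : 'rV_m, v != 0 & v *m M = 0.
Proof.
move=> km; exists (nz_row (kermx M)); last first.
  by apply/sub_kermxP; exact: nz_row_sub.
rewrite nz_row_eq0 -mxrank_eq0 mxrank_ker subn_eq0 -ltnNge.
exact: leq_ltn_trans (rank_leq_col M) km.
Qed.

Section GeodesicDistance.
Variables (R : realType) (n : nat) (r : R).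
Hypothesis r0 : 0 < r.
Implicit Types (p q u : 'rV[R]_n.+1).

(** The Cauchy-Schwarz inequality, from the norms of p + q and p - q. *)
Lemma cos_angle_itv p q : sphere r p -> sphere r q ->
  -1 <= dot p q / r ^+ 2 <= 1.
Proof.
move=> /(sphere_dot _ r0) pp /(sphere_dot _ r0) qq.
have r20 : 0 < r ^+ 2 by rewrite exprn_gt0.
rewrite ler_pdivlMr// ler_pdivrMr//.
have := dot_ge0 (p + q); have := dot_ge0 (p - q); rewrite !dotE pp qq (dotC q p).
by move=> ? ?; apply/andP; split; lra.
Qed.

(** The initial direction of a great circle from p to q.  It is unique unless
    q = p or q = - p; then any u of norm r orthogonal to p will do, and it exists
    because the sphere has positive dimension. *)
Lemma great_circle_direction p q : (0 < n)%N -> sphere r p -> sphere r q ->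
  exists u, [/\ dot p u = 0, dot u u = r ^+ 2 &
    let t := acos (dot p q / r ^+ 2) in q = cos t *: p + sin t *: u].
Proof.
move=> n0 sp sq; have /acosK := cos_angle_itv sp sq.
set t := acos _ => cost.
move/(sphere_dot _ r0): sp => pp; move/(sphere_dot _ r0): sq => qq.
have pq : dot p q = r ^+ 2 * cos t by rewrite cost mulrC divfK// sqrf_eq0 gt_eqF.
(* The component of q orthogonal to p, which is to be sin t *: u. *)
set w := q - cos t *: p.
have pw : dot p w = 0 by rewrite !dotE pq pp; ring.
have ww : dot w w = (r * sin t) ^+ 2.
  by rewrite exprMn sin2cos2 !dotE (dotC q p) pq pp qq; ring.
have [st|st] := eqVneq (sin t) 0.
  have [u u0 /matrixP/(_ 0 0)] := exists_left_kernel p^T (n0 : (1 < n.+1)%N).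
  rewrite !mxE => up; have {}up : dot p u = 0.
    by rewrite -[RHS]up; apply: eq_bigr => i _; rewrite mxE mulrC.
  have uu : enorm u != 0.
    rewrite gt_eqF// sqrtr_gt0 lt_def dot_ge0 andbT.
    by apply: contra u0 => /eqP/dot_eq0 ->.
  exists ((r / enorm u) *: u); rewrite /= !dotE up st scale0r addr0; split.
  - by rewrite mulr0.
  - by rewrite -[dot u u]sqr_sqrtr ?dot_ge0// -/(enorm u); field.
  - apply/eqP; rewrite -subr_eq0 -/w; apply/eqP/dot_eq0.
    by rewrite ww st mulr0 expr0n.
exists ((sin t)^-1 *: w); split.
- by rewrite dotZr pw mulr0.
- by rewrite dotZl dotZr ww; field.
- by rewrite /= scalerA divff// scale1r addrC subrK.
Qed.

Lemma is_derive_scalel (f : R -> R) (df t : R) p :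
  is_derive t 1 f df -> is_derive t 1 (fun x => f x *: p) (df *: p).
Proof.
move=> fdf.
have coord i j : is_derive t 1 (fun x => (f x *: p) i j) (df * p i j).
  have -> : (fun x => (f x *: p) i j) = p i j \*: f.
    by apply/funext => x; rewrite mxE mulrC.
  by rewrite mulrC; exact: is_deriveZ.
have d : derivable (fun x => f x *: p) t 1.
  by apply/derivable_mxP => i j; case: (coord i j).
apply: DeriveDef => //; rewrite derive_mx//.
by apply/matrixP => i j; rewrite !mxE; case: (coord i j).
Qed.

Lemma great_circle_geodesic p u (a b : R) :
  dot p p = r ^+ 2 -> dot u u = r ^+ 2 -> dot p u = 0 -> a <= b ->
  let c (t : R) : 'rV[R]_n.+1 := cos t *: p + sin t *: u in
  geodesic r a b c /\ curve_length a b c = (r * (b - a))%:E.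
Proof.
move=> pp uu pu ab c.
have circle x y : dot (x *: p + y *: u) (x *: p + y *: u) =
    r ^+ 2 * (x ^+ 2 + y ^+ 2).
  by rewrite !dotE pp uu (dotC u) pu; ring.
pose v (t : R) : 'rV[R]_n.+1 := (- sin t) *: p + cos t *: u.
have dc (t : R) : is_derive t 1 c (v t).
  by apply: is_deriveD; exact: is_derive_scalel.
have dv (t : R) : is_derive t 1 v (- c t).
  by rewrite opprD -!scaleNr; apply: is_deriveD; exact: is_derive_scalel.
have c1 : derive1 c = v by apply/funext => t; rewrite derive1E; case: (dc t).
have v1 t : derive1 v t = - c t by rewrite derive1E; case: (dv t).
split=> [t _|]; rewrite /curve_length c1.
  split.
  - by apply/sphere_dot => //; rewrite circle cos2Dsin2 mulr1.
  - by case: (dc t).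
  - by case: (dv t).
  - by move=> w wc; rewrite v1 dotNr wc oppr0.
rewrite (eq_integral (cst r%:E)) => [|t _]; last first.
  by rewrite /enorm circle sqrrN addrC cos2Dsin2 mulr1 sqrtr_sqr gtr0_norm.
rewrite integral_cst//= lebesgue_measure_itv/= lte_fin.
move: ab; rewrite le_eqVlt => /orP[/eqP ->|ab]; last first.
  by rewrite ab -EFinB -EFinM.
by rewrite ltxx mule0 subrr mulr0.
Qed.

Lemma acos_cos_le (x : R) : 0 <= x -> acos (cos x) <= x.
Proof.
move=> x0; have [xpi|/ltW xpi] := leP x pi; first by rewrite cosK// in_itv/= x0.
by rewrite (le_trans (acos_lepi _))// cos_geN1 cos_le1.
Qed.

(** A great circle gives the upper bound.  For the lower bound, a geodesic from p
    to q of length L has cos (L / r) = <p, q> / r^2, and acos (cos t) <= t for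
    all t >= 0. *)
Lemma sphere_distE p q : (0 < n)%N -> sphere r p -> sphere r q ->
  sphere_dist r p q = (r * acos (dot p q / r ^+ 2))%:E.
Proof.
move=> n0 sp sq; apply/eqP; rewrite eq_le; apply/andP; split.
  apply: ereal_inf_lbound; have [u [pu uu /= qE]] := great_circle_direction n0 sp sq.
  have t0 : 0 <= acos (dot p q / r ^+ 2) by apply: acos_ge0; exact: cos_angle_itv.
  have /(sphere_dot _ r0) pp := sp.
  have [geo len] := great_circle_geodesic pp uu pu t0.
  exists 0, (acos (dot p q / r ^+ 2)), (fun t => cos t *: p + sin t *: u).
  by split; rewrite // ?len ?subr0// cos0 sin0 scale1r scale0r addr0.
apply: le_ereal_inf_tmp => _ [a [b [c [ab geo <- <- ->]]]].
have [L [L0 -> ->]] := geodesic_length r0 ab geo.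
rewrite lee_fin mulrAC divff ?sqrf_eq0 ?gt_eqF// mul1r.
rewrite mulrC -ler_pdivlMr//; apply: acos_cos_le.
by rewrite divr_ge0// ltW.
Qed.

End GeodesicDistance.

(** * Graphs *)

Definition adj (T : Type) (G : graph T) (x y : T) := edges G [set x; y].

Lemma eq_set2 (T : Type) (a b c d : T) : [set a; b] = [set c; d] ->
  (a = c /\ b = d) \/ (a = d /\ b = c).
Proof.
move=> abcd.
have a_cd : [set c; d] a by rewrite -abcd; left.
have b_cd : [set c; d] b by rewrite -abcd; right.
have c_ab : [set a; b] c by rewrite abcd; left.
have d_ab : [set a; b] d by rewrite abcd; right.
by case: a_cd; case: b_cd; case: c_ab; case: d_ab => /= *; subst; auto.
Qed.

Section Graphs.
Variables (T : Type) (G : graph T).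
Implicit Types (x y z w : T) (u v : nat -> T).
Local Notation V := (vertices G).
Local Notation "x ~ y" := (adj G x y) (at level 70).

Lemma adjC x y : x ~ y -> y ~ x.
Proof. by rewrite /adj setUC. Qed.

Lemma adjP x y : x ~ y -> [/\ V x, V y & x <> y].
Proof.
move=> /edges_subset2[a [b [Va Vb ab xyab]]].
by have [[-> ->]|[-> ->]] := eq_set2 xyab; split=> //; exact/nesym.
Qed.

Lemma path_inj v k : set_inj [set i | (i <= k)%N] v ->
  forall i j, (i <= k)%N -> (j <= k)%N -> v i = v j -> i = j.
Proof. by move=> vI i j ik jk; apply: vI; rewrite inE. Qed.

Lemma path_of_length1 x y : x ~ y -> path_of_length G x y 1.
Proof.
move=> xy; have [_ _ neq] := adjP xy.
exists (fun i => if i is 0%N then x else y); split => //; last by case.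
by move=> [|[|i]] [|[|j]]; rewrite !inE//= => _ _ e; case: neq.
Qed.

Lemma path_of_length2 x z y : x ~ z -> z ~ y -> x <> y -> path_of_length G x y 2.
Proof.
move=> xz zy xy; have [_ _ xNz] := adjP xz; have [_ _ zNy] := adjP zy.
exists (fun i => match i with 0%N => x | 1%N => z | _ => y end).
split => //; last by case=> [|[|]].
move=> [|[|[|i]]] [|[|[|j]]]; rewrite !inE//= => _ _ e; exfalso;
  by [apply: xNz | apply: zNy | apply: xy].
Qed.

Lemma path_of_length_ge1 x y k : x <> y -> path_of_length G x y k -> (1 <= k)%N.
Proof. by case: k => // xy [v [v0 vk _ _]]; case: xy; rewrite -v0 vk. Qed.

Lemma path_of_length_ge2 x y k : x <> y -> ~ x ~ y ->
  path_of_length G x y k -> (2 <= k)%N.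
Proof.
move=> neq nadj p; have := path_of_length_ge1 neq p.
case: k p => [|[|k]]// [v [v0 v1 _ /(_ 0%N isT)]].
by rewrite v0 v1 => /nadj.
Qed.

Section Distance.
Variable R : realType.

Lemma graph_dist_min x y k : path_of_length G x y k ->
  (forall j, path_of_length G x y j -> (k <= j)%N) ->
  graph_dist R G x y = k%:R%:E.
Proof.
move=> p kmin; apply/eqP; rewrite eq_le; apply/andP; split.
  by apply: ereal_inf_lbound; exists k.
by apply: le_ereal_inf_tmp => _ [j /kmin kj <-]; rewrite lee_fin ler_nat.
Qed.

Lemma graph_dist_adj x y : x ~ y -> graph_dist R G x y = 1%:R%:E.
Proof.
move=> xy; apply: graph_dist_min; first exact: path_of_length1.
by have [_ _ neq] := adjP xy => j; exact: path_of_length_ge1.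
Qed.

Lemma graph_dist_common_neighbour x z y : x ~ z -> z ~ y -> x <> y -> ~ x ~ y ->
  graph_dist R G x y = 2%:R%:E.
Proof.
move=> xz zy xy nxy; apply: graph_dist_min; first exact: path_of_length2 xz zy xy.
by move=> j; exact: path_of_length_ge2.
Qed.

Lemma graph_dist_ge2 x y : x <> y -> ~ x ~ y -> (2%:R%:E <= graph_dist R G x y)%E.
Proof.
move=> xy nxy; apply: le_ereal_inf_tmp => _ [j p <-].
by rewrite lee_fin ler_nat; exact: path_of_length_ge2 p.
Qed.

End Distance.

Section Connected.
Hypothesis connected : forall x y, V x -> V y -> exists k, path_of_length G x y k.

Lemma connected_ind (P : T -> Prop) x : V x -> P x ->
  (forall y z, P y -> y ~ z -> P z) -> forall y, V y -> P y.
Proof.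
move=> Vx Px Padj y Vy; have [k [v [v0 vk _ vadj]]] := connected Vx Vy.
have: forall i, (i <= k)%N -> P (v i).
  elim=> [|i IH ik]; first by rewrite v0.
  exact: Padj (IH (ltnW ik)) (vadj _ ik).
by move/(_ k (leqnn k)); rewrite vk.
Qed.

(** If every neighbour of a neighbour of x were x or adjacent to x, then by
    connectedness so would be every vertex. *)
Lemma incomplete_induced_path : ~ complete G ->
  exists x z y, [/\ x ~ z, z ~ y, x <> y & ~ x ~ y].
Proof.
move=> ncomp; apply: contrapT => no; apply: ncomp => x y Vx Vy xy.
suff [] : x = y \/ x ~ y by [].
move: y Vy {xy}; apply: (connected_ind Vx); first by left.
move=> y z [<-|xy] yz; first by right.
have [|xz] := EM (x = z); first by left.
by right; apply: contrapT => nxz; apply: no; exists x, y, z.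
Qed.

Section DegreeAtMost2.
Hypothesis midpoint_neighbours : forall x z y w,
  z ~ x -> z ~ y -> x <> y -> ~ x ~ y -> z ~ w -> w = x \/ w = y.

(** The middle vertex of an induced path with two edges lies in no triangle,
    since its only neighbours are the ends of that path.  The property of lying
    in no triangle passes from a vertex v to a neighbour u: if u a b were a
    triangle, v and a would be nonadjacent neighbours of u, leaving no room for
    b. *)
Lemma no_triangle : ~ complete G -> forall a b c, a ~ b -> b ~ c -> ~ a ~ c.
Proof.
move=> /incomplete_induced_path[x [z [y [xz zy xy nxy]]]].
have [_ Vz _] := adjP xz.
suff no z' : V z' -> forall a b, z' ~ a -> z' ~ b -> ~ a ~ b.
  by move=> a b c ab bc; have [_ Vb _] := adjP ab; exact: (no b Vb _ _ (adjC ab)).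
move: z'; apply: (connected_ind Vz).
  move=> a b za zb ab; have [_ _ aNb] := adjP ab.
  have nbr w : z ~ w -> w = x \/ w = y by apply: midpoint_neighbours => //; exact: adjC.
  have [eqa|eqa] := nbr _ za; have [eqb|eqb] := nbr _ zb; subst => //.
  by apply: nxy; exact: adjC.
move=> v u tri vu a b ua ub ab; have [_ _ aNb] := adjP ab.
have uv := adjC vu.
have vNa : v <> a by move=> va; apply: (tri u b) => //; rewrite va.
have nva : ~ v ~ a by move=> va; exact: (tri u a).
have [bv|ba] := midpoint_neighbours uv ua vNa nva ub; last exact: aNb.
by apply: nva; rewrite -bv; exact: adjC.
Qed.

(** Without triangles, any two distinct neighbours of a vertex are
    nonadjacent. *)
Lemma degree_le2 : ~ complete G -> forall z a b c,
  z ~ a -> z ~ b -> z ~ c -> a <> b -> c = a \/ c = b.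
Proof.
move=> ncomp z a b c za zb zc ab; apply: midpoint_neighbours zc => //.
exact: no_triangle (adjC za) zb.
Qed.

End DegreeAtMost2.

Section PathOrCycle.
Variable M : nat.
Hypothesis diameter : forall x y, V x -> V y ->
  exists2 k, (k <= M)%N & path_of_length G x y k.
Hypothesis degree2 : forall z a b c,
  z ~ a -> z ~ b -> z ~ c -> a <> b -> c = a \/ c = b.

Lemma inner_neighbour v L i w :
  set_inj [set i | (i <= L)%N] v -> (forall i, (i < L)%N -> v i ~ v i.+1) ->
  (0 < i < L)%N -> v i ~ w -> w = v i.-1 \/ w = v i.+1.
Proof.
move=> /path_inj vI vadj /andP[i0 iL] iw; apply: degree2 iw _ => //.
- by apply: adjC; have := vadj i.-1; rewrite prednK//; apply; lia.
- exact: vadj.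
- by move=> /vI; lia.
Qed.

(** Along a path v, a walk can leave the segment only through its ends.  Starting
    in the middle of a path with 2 M + 2 edges, M steps do not suffice to reach
    an end, contrary to the bound on the diameter. *)
Lemma path_length_bound x y L : path_of_length G x y L -> (L < M.*2.+2)%N.
Proof.
move=> [v [_ _ vI vadj]]; rewrite ltnNge; apply/negP => ML.
have Vv i : (i <= L)%N -> V (v i).
  case: i => [|i] iL; first by have [] := adjP (vadj 0%N ltac:(lia)).
  by have [] := adjP (vadj i iL).
have [k kM [u [u0 uk _ uadj]]] := diameter (Vv M.+1 ltac:(lia)) (Vv 0%N isT).
have : forall i, (i <= k)%N ->
    exists2 j, (M.+1 - i <= j <= M.+1 + i)%N & u i = v j.
  elim=> [|i IH ik]; first by exists M.+1 => //; lia.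
  have [j jM uj] := IH (ltnW ik).
  have := uadj i ik; rewrite uj => /(inner_neighbour vI vadj)[|->|->]; first by lia.
    by exists j.-1 => //; lia.
  by exists j.+1 => //; lia.
move=> /(_ k (leqnn k))[j jM]; rewrite uk => /(path_inj vI); lia.
Qed.

(** A neighbour of the end of a longest path lies on the path, as otherwise the
    path could be extended.  Inner vertices already have two neighbours on the
    path, so w is the predecessor of the end or the other end. *)
Lemma endpoint_neighbour v L w :
  set_inj [set i | (i <= L)%N] v -> (forall i, (i < L)%N -> v i ~ v i.+1) ->
  (forall x y, ~ path_of_length G x y L.+1) ->
  (0 < L)%N -> v L ~ w -> w = v L.-1 \/ w = v 0%N.
Proof.
move=> vI vadj Lmax L0 Lw.
have vinj := path_inj vI.
have [[j jL wj]|wNv] := EM (exists2 j, (j <= L)%N & w = v j).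
  have [j0|j0] := eqVneq j 0%N; first by right; rewrite wj j0.
  have [jL'|jL'] := eqVneq j L.
    by have [_ _ []] := adjP Lw; rewrite wj jL'.
  left; have jv := adjC Lw; rewrite wj in jv *.
  have [||] := inner_neighbour vI vadj _ jv; first by lia.
    by move/vinj; lia.
  by move/vinj => e; congr v; lia.
exfalso; apply: (Lmax (v 0%N) w).
exists (fun i => if (i <= L)%N then v i else w); split => //.
- by rewrite ltnn.
- move=> i j; rewrite !inE/= => iL jL.
  case: ifPn => iL'; case: ifPn => jL' // e.
  - exact: vinj.
  - by case: wNv; exists i.
  - by case: wNv; exists j.
  - lia.
- move=> i iL; rewrite -ltnS iL; case: ltnP => iL'; first exact: vadj.
  by have -> : i = L by lia.
Qed.

(** A longest path exists by path_length_bound.  Its vertices are closed under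
    adjacency, so by connectedness they are all the vertices, and the only edge
    outside the path which can exist joins its two ends. *)
Lemma path_or_cycle : (exists x y, path_of_length G x y 2) ->
  (exists2 m, (1 <= m)%N & is_path_graph G m) \/
  (exists2 m, (3 <= m)%N & is_cycle_graph G m).
Proof.
move=> p2.
pose P k := `[< exists x y, path_of_length G x y k >].
have exP : exists k, P k by exists 2%N; apply/asboolP.
have ubP k : P k -> (k <= M.*2.+2)%N.
  by move=> /asboolP[x [y /path_length_bound/ltnW]].
case: (ex_maxnP exP ubP) => L /asboolP[x [y [v [_ _ vI vadj]]]] Lmax {x y exP ubP}.
have L2 : (2 <= L)%N by apply: Lmax; apply/asboolP.
have noext x y : ~ path_of_length G x y L.+1.
  move=> p; suff /Lmax : P L.+1 by rewrite ltnn.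
  by apply/asboolP; exists x, y.
have vinj := path_inj vI.
have L0 : (0 < L)%N by lia.
(* The path is traversed backwards, to turn its start into its end. *)
have nbr0 w : v 0%N ~ w -> w = v 1%N \/ w = v L.
  pose u i := v (L - i)%N.
  have := @endpoint_neighbour u L w; rewrite /u subnn subn0.
  have -> : (L - L.-1 = 1)%N by lia.
  apply=> //.
    by move=> i j; rewrite !inE/= => iL jL /vinj; lia.
  move=> i iL; apply: adjC; have -> : (L - i = (L - i.+1).+1)%N by lia.
  by apply: vadj; lia.
have nbrL w : v L ~ w -> w = v L.-1 \/ w = v 0%N by exact: endpoint_neighbour.
have nbr i w : (i <= L)%N -> v i ~ w ->
    [\/ (i < L)%N /\ w = v i.+1, (0 < i)%N /\ w = v i.-1,
      i = 0%N /\ w = v L | i = L /\ w = v 0%N].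
  move=> iL iw.
  have [i0|i0] := posnP i.
    rewrite i0 in iw *; have [->|->] := nbr0 _ iw; last by constructor 3.
    by constructor 1.
  have [iL'|iL'] := eqVneq i L.
    rewrite iL' in iw *; have [->|->] := nbrL _ iw; last by constructor 4.
    by constructor 2.
  have [|->|->] := inner_neighbour vI vadj _ iw; first by lia.
    by constructor 2.
  by constructor 1; split=> //; lia.
have Vv i : (i <= L)%N -> V (v i).
  case: i => [|i] iL; first by have [] := adjP (vadj 0%N L0).
  by have [] := adjP (vadj i iL).
have VE y : V y -> exists2 i, (i <= L)%N & y = v i.
  move: y; apply: (connected_ind (Vv 0%N isT)); first by exists 0%N.
  move=> y z [i iL ->] /(nbr _ _ iL)[] [i' ->]; last 2 first.
  - by exists L.
  - by exists 0%N.
  - by exists i.+1.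
  - by exists i.-1 => //; lia.
(* Path and cycle graphs are indexed from 1. *)
pose u i := v i.-1.
have uI : set_inj [set i | (1 <= i <= L.+1)%N] u.
  by move=> i j; rewrite !inE/= => iL jL /vinj; lia.
have Vu : V = u @` [set i | (1 <= i <= L.+1)%N].
  apply/seteqP; split => [y /VE[i iL ->]|_ [i /= iL <-]]; first by exists i.+1.
  by apply: Vv; lia.
have Eu e : (exists2 i, (1 <= i < L.+1)%N & [set u i; u i.+1] = e) -> edges G e.
  by move=> [[|i]//= iL <-]; apply: vadj; lia.
have uE e : edges G e -> e = [set v 0%N; v L] \/
    exists2 i, (1 <= i < L.+1)%N & [set u i; u i.+1] = e.
  move=> Ge; have [a [b [Va Vb ab eE]]] := edges_subset2 Ge.
  rewrite eE in Ge *; have [i iL ai] := VE _ Va.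
  rewrite ai in Ge *; have [] := nbr _ _ iL Ge => -[iL' ->].
  - by right; exists i.+1 => //; lia.
  - right; exists i; first by lia.
    by rewrite setUC /u /=.
  - by left; rewrite iL'.
  - by left; rewrite iL' setUC.
have [v0L|nv0L] := EM (v 0%N ~ v L); [right|left]; exists L.+1 => //.
  exists u; split => //; apply/seteqP; split => e.
    by move=> /uE[->|?]; [right|left].
  by move=> [/Eu//|->].
exists u; split => //; apply/seteqP; split => e; last exact: Eu.
by move=> Ge; have [e0L|//] := uE _ Ge; case: nv0L; rewrite /adj -e0L.
Qed.

End PathOrCycle.
End Connected.
End Graphs.

(** * Equidistant and orthogonal sets *)

Section EquidistantSets.

Lemma card_le_I (U : pointedType) (A : set U) m :
  (forall k (x : 'I_k -> U), injective x -> (forall i, A (x i)) -> (k <= m)%N) ->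
  (A #<= `I_m)%card.
Proof.
move=> bound.
suff noI k : (`I_k #<= A)%card -> (k <= m)%N.
  have [[k Ak]|/finite_setPn/contrapT infA] := EM (finite_set A).
    by rewrite (card_le_eql Ak) card_le_II; apply: noI; rewrite (card_le_eqr Ak).
  have /noI : (`I_m.+1 #<= A)%card by apply: card_le_trans infA; exact: card_leT.
  by rewrite ltnn.
move=> /pcard_leP/injfunPex[x xA xI].
apply: (bound k (x \o val)) => [i j /= xij|i]; last by apply: xA => /=; exact: ltn_ord.
by apply/val_inj/xI => //; rewrite inE/= ltn_ord.
Qed.

Variables (R : realType) (d : nat).
Implicit Types (A : set 'rV[R]_d) (p q : 'rV[R]_d).

Lemma gram_mx m (X : 'I_m -> 'rV[R]_d) :
  (\matrix_i X i) *m (\matrix_i X i)^T = \matrix_(i, j) dot (X i) (X j).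
Proof.
apply/matrixP => i j; rewrite !mxE; apply: eq_bigr => k _.
by rewrite !mxE.
Qed.

(** If the rows of X are the m given vectors, then X X^T = (rho - c) I + c J with
    J the all-ones matrix.  Adding to X a column of ones and to X^T a row of - c
    cancels c J; so a multiple of the identity of size m factors through
    dimension d + 1, and m <= d + 1. *)
Lemma card_le_equidistant A (rho c : R) : rho != c ->
  (forall p, A p -> dot p p = rho) ->
  (forall p q, A p -> A q -> p != q -> dot p q = c) ->
  (A #<= `I_d.+1)%card.
Proof.
move=> rhoc App Apq; apply: card_le_I => m x xI xA; rewrite -addn1.
pose X := \matrix_i x i.
pose L := row_mx X (const_mx 1 : 'M[R]_(m, 1)).
pose N := col_mx X^T (const_mx (- c) : 'M[R]_(1, m)).
apply: (@mulmx1_min _ _ _ L ((rho - c)^-1 *: N)).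
rewrite -scalemxAr mul_row_col gram_mx; apply/matrixP => i j.
rewrite !mxE big_ord1 !mxE mul1r.
have [->|ij] := eqVneq i j; first by rewrite App// mulVf// subr_eq0.
by rewrite Apq ?(inj_eq xI)// subrr mulr0.
Qed.

Lemma card_le_orthogonal A (rho : R) : rho != 0 ->
  (forall p, A p -> dot p p = rho) ->
  (forall p q, A p -> A q -> p != q -> dot p q = 0) ->
  (A #<= `I_d)%card.
Proof.
move=> rho0 App Apq; apply: card_le_I => m x xI xA.
pose X := \matrix_i x i.
apply: (@mulmx1_min _ _ _ X (rho^-1 *: X^T)).
rewrite -scalemxAr gram_mx; apply/matrixP => i j; rewrite !mxE.
have [->|ij] := eqVneq i j; first by rewrite App// mulVf.
by rewrite Apq ?(inj_eq xI)// mulr0.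
Qed.

End EquidistantSets.

(** * Orthogonal and antipodal vertices *)

Section CrossPolytope.
Variables (R : realType) (T : Type) (G : graph T) (n : nat).
Variables (f : T -> 'rV[R]_n.+1) (rho : R).
Hypothesis rho0 : rho != 0.
Local Notation V := (vertices G).
Hypothesis f_inj : set_inj V f.
Hypothesis f_norm : forall x, V x -> dot (f x) (f x) = rho.
Hypothesis f_adj : forall x y, V x -> V y -> adj G x y -> dot (f x) (f y) = 0.
Hypothesis f_nadj : forall x y, V x -> V y -> x <> y -> ~ adj G x y -> f y = - f x.

(** A representative of the line spanned by p: the choice operator depends only
    on the set {p, - p}. *)
Let rep (p : 'rV[R]_n.+1) := xget 0 [set q | q = p \/ q = - p].

Let repP p : rep p = p \/ rep p = - p.
Proof. by apply: (@xgetPex _ 0 [set q | q = p \/ q = - p]); exists p; left. Qed.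

Let repN p : rep (- p) = rep p.
Proof.
congr xget; apply/seteqP; split => q /=; rewrite opprK; tauto.
Qed.

Let f_neq0 x : V x -> f x <> 0.
Proof.
by move=> /f_norm + f0; rewrite f0 dot0r => /esym/eqP; apply/negP.
Qed.

Let f_orth x y : V x -> V y -> f x <> f y -> f y <> - f x -> dot (f x) (f y) = 0.
Proof.
move=> Vx Vy xy nxy; apply: f_adj => //; apply: contrapT => nadj.
by apply: nxy; apply: f_nadj => // xy'; apply: xy; rewrite xy'.
Qed.

(** Representatives of different lines are orthogonal, so there are at most
    n + 1 of them, one for each coordinate axis. *)
Lemma line_axes : exists g : 'rV[R]_n.+1 -> 'I_n.+1,
  forall x y, V x -> V y -> g (rep (f x)) = g (rep (f y)) -> rep (f x) = rep (f y).
Proof.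
have : ((rep \o f) @` V #<= `I_n.+1)%card.
  apply: (card_le_orthogonal rho0) => [_ [x Vx <-]|].
    by rewrite /=; have [->|->] := repP (f x); rewrite ?dotNl ?dotNr ?opprK f_norm.
  move=> _ _ [x Vx <-] [y Vy <-] /= /eqP xy.
  have /f_orth : f x <> f y by move=> e; apply: xy; rewrite e.
  move=> /(_ Vx Vy); suff nxy : f y <> - f x.
    move=> /(_ nxy); have [->|->] := repP (f x); have [->|->] := repP (f y);
      by rewrite ?dotNl ?dotNr => ->; rewrite ?oppr0.
  by move=> e; apply: xy; rewrite e repN.
move=> /pcard_leP/injfunPex[g gI ginj]; exists (fun p => inord (g p)).
move=> x y Vx Vy.
have VS z : V z -> ((rep \o f) @` V) (rep (f z)) by move=> Vz; exists z.
have /gI/= gx := VS _ Vx; have /gI/= gy := VS _ Vy.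
move=> /(congr1 val); rewrite /= !inordK// => /ginj.
by apply; rewrite inE; exact: VS.
Qed.

(** A vertex x is sent to the axis of the line through f x, on the positive side
    if and only if f x is the chosen representative of that line.  This maps
    orthogonal pairs to orthogonal pairs and antipodal pairs to antipodal pairs;
    H is the subgraph of G_n induced on the image. *)
Lemma subgraph_of_Gn :
  exists2 H : graph 'rV[R]_n.+1, subgraph H (Gn R n) & isomorphic G H.
Proof.
have [g gI] := line_axes.
pose s p : R := (if rep p == p then 1 else -1) * (2 / pi).
pose F x : 'rV[R]_n.+1 := s (f x) *: delta_mx 0 (g (rep (f x))).
have pi2 : 0 < 2 / pi :> R by rewrite divr_gt0// pi_gt0.
have s0 p : s p != 0.
  by rewrite mulf_neq0 ?(gt_eqF pi2)//; case: ifP => _; rewrite ?oppr_eq0 oner_eq0.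
have sN p : p <> 0 -> s (- p) = - s p.
  move=> p0; have pNp : p != - p.
    apply/eqP => /eqP; rewrite -subr_eq0 opprK -mulr2n -scaler_nat scaler_eq0.
    by rewrite pnatr_eq0/= => /eqP.
  rewrite /s repN -mulNr; congr (_ * _).
  have [->|->] := repP p; first by rewrite eqxx (negbTE pNp).
  by rewrite eqxx eq_sym (negbTE pNp) opprK.
have dotF x y : dot (F x) (F y) =
    s (f x) * s (f y) * (g (rep (f x)) == g (rep (f y)))%:R.
  rewrite dotZl dotZr mulrA; congr (_ * _).
  rewrite /dot (bigD1 (g (rep (f x))))//= big1 => [|j /negbTE jx].
    by rewrite !mxE !eqxx mul1r addr0.
  by rewrite !mxE jx mul0r.
have orthF x y : V x -> V y -> dot (F x) (F y) = 0 <-> (f x <> f y /\ f y <> - f x).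
  move=> Vx Vy; rewrite dotF; split.
    move=> /eqP; rewrite mulf_eq0 (negbTE (mulf_neq0 (s0 _) (s0 _)))/=.
    rewrite pnatr_eq0 eqb0 => /eqP gxy.
    by split=> e; apply: gxy; rewrite e ?repN.
  move=> [xy nxy]; case: eqP => [/(gI _ _ Vx Vy) e|]; last by rewrite mulr0.
  exfalso; move: e.
  have [->|->] := repP (f x); have [->|->] := repP (f y) => e.
  - exact: xy.
  - by apply: nxy; rewrite e opprK.
  - by apply: nxy; rewrite e.
  - by apply: xy; exact: oppr_inj.
have adjF x y : V x -> V y -> (adj G x y <-> dot (F x) (F y) = 0).
  move=> Vx Vy; rewrite orthF//; split=> [xy|[xy nxy]]; last first.
    apply: contrapT => nadj; apply: nxy; apply: f_nadj => // e.
    by apply: xy; rewrite e.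
  have fxy := f_adj Vx Vy xy.
  split=> e; move: fxy; rewrite e ?dotNr f_norm// => /eqP;
    by rewrite ?oppr_eq0 (negbTE rho0).
have Finj : set_inj V F.
  move=> x y; rewrite !inE => Vx Vy Fxy.
  have : dot (F x) (F y) <> 0.
    by rewrite Fxy => e; have [_ _] := adjP ((adjF y y Vy Vy).2 e).
  rewrite orthF// => /not_andP[/contrapT fxy|/contrapT fyx].
    by apply: f_inj; rewrite ?inE.
  move: Fxy; rewrite /F fyx repN sN; last exact: f_neq0.
  move=> /eqP; rewrite scaleNr -subr_eq0 opprK -mulr2n -scaler_nat scalerA.
  rewrite scaler_eq0 mulf_eq0 pnatr_eq0 (negbTE (s0 _))/=.
  move=> /eqP/matrixP/(_ 0 (g (rep (f x)))).
  by rewrite !mxE !eqxx/= => /eqP; rewrite oner_eq0.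
have FGn x : Gn_vertices (F x).
  exists (g (rep (f x))); rewrite /F /s.
  by case: ifP => _; rewrite ?mul1r ?mulN1r; first [by left|by right].
have H2 e : (@Gn_edges R n `&` [set e | e `<=` F @` V]) e ->
    exists x y, [/\ (F @` V) x, (F @` V) y, x <> y & e = [set x; y]].
  move=> [/Gn_edges_subset2[x [y [_ _ xy ->]]] /= sub].
  by exists x, y; split => //; [apply: (sub x); left|apply: (sub y); right].
exists (Graph H2); first by split=> [_ /= [x _ <-]|e []//]; exact: FGn.
exists F; first by split=> [x Vx|//|//]; exists x.
move=> x y Vx Vy; rewrite -[edges G _]/(adj G x y) adjF//; split => [Fxy|].
  split; first by exists (F x), (F y).
  by move=> _ [->|->]; [exists x|exists y].
move=> [[a [b [_ _ ab xyab]]] _].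
by have [[-> ->]|[-> ->]] := eq_set2 xyab; rewrite // dotC.
Qed.

End CrossPolytope.

(** * Isometric embeddings into the sphere *)

Section Embedding.
Variables (R : realType) (T : Type) (G : graph T) (n : nat) (r : R).
Variable f : T -> 'rV[R]_n.+1.
Hypotheses (n0 : (0 < n)%N) (r0 : 0 < r) (emb : isometric_embedding G r f).
Local Notation V := (vertices G).
Local Notation "x ~ y" := (adj G x y) (at level 70).
Implicit Types x y z w : T.

Let fS x : V x -> sphere r (f x). Proof. by case: emb => + _ _; apply. Qed.

Lemma embedding_inj x y : V x -> V y -> f x = f y -> x = y.
Proof. by case: emb => _ fI _ Vx Vy; apply: fI; rewrite inE. Qed.

Lemma embedding_norm x : V x -> dot (f x) (f x) = r ^+ 2.
Proof. by move/fS/sphere_dot; apply. Qed.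

Lemma embedding_dist x y : V x -> V y ->
  graph_dist R G x y = (r * acos (dot (f x) (f y) / r ^+ 2))%:E.
Proof.
by case: emb => _ _ dE Vx Vy; rewrite dE// sphere_distE//; exact: fS.
Qed.

Lemma embedding_angle x y : V x -> V y ->
  -1 <= dot (f x) (f y) / r ^+ 2 <= 1.
Proof. by move=> Vx Vy; apply: cos_angle_itv; rewrite //; exact: fS. Qed.

Lemma embedding_dot x y (k : R) : V x -> V y -> graph_dist R G x y = k%:E ->
  k / r <= pi /\ dot (f x) (f y) = r ^+ 2 * cos (k / r).
Proof.
move=> Vx Vy; rewrite embedding_dist// => -[<-].
have rr0 := gt_eqF r0; rewrite mulrAC divff ?rr0// mul1r.
rewrite acosK ?in_itv/= ?embedding_angle//; split.
  by apply: acos_lepi; exact: embedding_angle.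
by rewrite mulrC divfK// sqrf_eq0 rr0.
Qed.

(** The distance on the sphere is at most r * pi. *)
Lemma embedding_diameter x y : V x -> V y ->
  exists2 k, (k <= Num.truncn (r * pi))%N & path_of_length G x y k.
Proof.
move=> Vx Vy; have := embedding_dist Vx Vy.
set M := Num.truncn _ => dE.
have : (graph_dist R G x y < M.+1%:R%:E)%E.
  rewrite dE lte_fin; apply: le_lt_trans (truncnS_gt (r * pi)).
  by rewrite ler_pM2l// acos_lepi// embedding_angle.
by move=> /ereal_inf_lt[_ [k p <-]]; rewrite lte_fin ltr_nat ltnS => kM; exists k.
Qed.

Lemma embedding_adj x y : x ~ y -> dot (f x) (f y) = r ^+ 2 * cos (r^-1).
Proof.
move=> xy; have [Vx Vy _] := adjP xy.
by have [_ ->] := embedding_dot Vx Vy (graph_dist_adj R xy); rewrite div1r.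
Qed.

(** With C := cos (1 / r), the squared norm of f x + f y - 2 C f z is r^2 times
    2 + 2 cos (2 / r) - 8 C^2 + 4 C^2, which is 0 as cos (2 / r) = 2 C^2 - 1. *)
Lemma embedding_midpoint x z y : x ~ z -> z ~ y -> x <> y -> ~ x ~ y ->
  2 / r <= pi /\ f x + f y = (2 * cos (r^-1)) *: f z.
Proof.
move=> xz zy xy nxy; have [Vx Vz _] := adjP xz; have [_ Vy _] := adjP zy.
have [two_le_pi fxy] :=
  embedding_dot Vx Vy (graph_dist_common_neighbour R xz zy xy nxy).
split=> //; apply/eqP; rewrite -subr_eq0; apply/eqP/dot_eq0.
have fxz := embedding_adj xz; have fzy := embedding_adj zy.
rewrite !dotE (dotC (f z) (f x)) (dotC (f y) (f x)) (dotC (f y) (f z)).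
rewrite fxy fxz fzy !embedding_norm// (_ : 2 / r = r^-1 *+ 2); last first.
  by rewrite mulr_natl.
by rewrite cos_mulr2n; ring.
Qed.

Lemma card_complete : complete G -> (V #<= `I_n.+2)%card.
Proof.
move=> comp.
have fI : {in V &, injective f}.
  by move=> x y; rewrite !inE; exact: embedding_inj.
rewrite -(card_le_eql (inj_card_eq fI)).
have [[x [y [Vx Vy xy]]]|sub1] := EM (exists x y, [/\ V x, V y & x <> y]).
  apply: (@card_le_equidistant _ _ _ (r ^+ 2) (dot (f x) (f y))).
  - apply/eqP => e; apply: xy; apply: embedding_inj => //.
    apply/eqP; rewrite -subr_eq0; apply/eqP/dot_eq0.
    by rewrite !dotE !embedding_norm// (dotC (f y)) e; ring.
  - by move=> _ [z Vz <-]; exact: embedding_norm.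
  - move=> _ _ [z Vz <-] [w Vw <-] /eqP zw.
    rewrite !embedding_adj//; apply: comp => // e.
    by apply: zw; rewrite e.
(* With at most one vertex there is no inner product to prescribe. *)
apply: (@card_le_equidistant _ _ _ (r ^+ 2) 0).
- by rewrite sqrf_eq0 gt_eqF.
- by move=> _ [z Vz <-]; exact: embedding_norm.
- move=> _ _ [z Vz <-] [w Vw <-] /eqP zw; exfalso.
  by apply: sub1; exists z, w; split=> // e; apply: zw; rewrite e.
Qed.

(** As cos (1 / r) is nonzero, the midpoint identity determines y from x and z,
    and z from x and y. *)
Lemma midpoint_degree2 : 2 / r < pi -> forall x z y w,
  z ~ x -> z ~ y -> x <> y -> ~ x ~ y -> z ~ w -> w = x \/ w = y.
Proof.
move=> rpi x z y w zx zy xy nxy zw.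
have cos0 : 2 * cos r^-1 != 0.
  rewrite gt_eqF// mulr_gt0//; apply: cos_gt0_pihalf.
  have : 0 < r^-1 by rewrite invr_gt0.
  have := pi_gt0 R; move: rpi; rewrite -[2 / r]/(2 * r^-1) => ? ? ?.
  by apply/andP; split; lra.
apply: contrapT => /not_orP[wx wy].
have [_ Vx _] := adjP zx; have [Vz Vy _] := adjP zy; have [_ Vw zNw] := adjP zw.
have [_ mid] := embedding_midpoint (adjC zx) zy xy nxy.
(* Otherwise z would be the midpoint of u, w as well as of u, u'. *)
have reflect u u' : z ~ u -> z ~ u' -> u <> u' -> f u + f u' = (2 * cos r^-1) *: f z ->
    w <> u -> w <> u' -> u ~ w.
  move=> zu zu' uu' mid' wu wu'; apply: contrapT => nuw.
  have uw : u <> w by move/esym.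
  have [_] := embedding_midpoint (adjC zu) zw uw nuw.
  have [_ Vu' _] := adjP zu'.
  by rewrite -mid' => /addrI/(embedding_inj Vw Vu').
have xw := reflect _ _ zx zy xy mid wx wy.
have yw : y ~ w by apply: (reflect _ x) => //; [exact/nesym | rewrite addrC].
have [_] := embedding_midpoint xw (adjC yw) xy nxy.
rewrite mid => /(scalerI cos0) /(embedding_inj Vz Vw); exact: zNw.
Qed.

(** At this radius, adjacent vertices are at the angle 1 / r = pi / 2, and vertices
    at distance at least 2 = r * pi are antipodal. *)
Lemma embedding_right_angle : r = 2 / pi ->
  exists2 H : graph 'rV[R]_n.+1, subgraph H (Gn R n) & isomorphic G H.
Proof.
move=> rE.
have pi0 : pi != 0 :> R by rewrite gt_eqF// pi_gt0.
have rV : r^-1 = pi / 2 by rewrite rE invf_div.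
apply: (@subgraph_of_Gn _ _ _ _ f (r ^+ 2)).
- by rewrite sqrf_eq0 gt_eqF.
- by case: emb.
- exact: embedding_norm.
- by move=> x y _ _ xy; rewrite (embedding_adj xy) rV cos_pihalf mulr0.
move=> x y Vx Vy xy nxy.
have := graph_dist_ge2 R xy nxy.
rewrite embedding_dist// lee_fin => dge2.
have ang := embedding_angle Vx Vy.
have api : acos (dot (f x) (f y) / r ^+ 2) = pi.
  apply/eqP; rewrite eq_le acos_lepi//=.
  by rewrite -(ler_pM2l r0) (le_trans _ dge2)// rE divfK.
have fxy : dot (f x) (f y) = - r ^+ 2.
  have := @acosK R (dot (f x) (f y) / r ^+ 2).
  rewrite in_itv/= ang api cospi => /(_ isT) e.
  by rewrite -[LHS](divfK (x := r ^+ 2)) ?sqrf_eq0 ?gt_eqF// -e mulN1r.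
apply/eqP; rewrite -subr_eq0 opprK; apply/eqP/dot_eq0.
by rewrite !dotE (dotC (f y)) !embedding_norm// fxy; ring.
Qed.

End Embedding.

Theorem corollary2p5 (R : realType) (T : Type) (G : graph T) (n : nat) (r : R)
    (f : T -> 'rV[R]_n.+1) :
  (2 <= n)%N -> 0 < r -> isometric_embedding G r f ->
  [\/ exists2 m : nat, (1 <= m)%N & is_path_graph G m,
      exists2 m : nat, (3 <= m)%N & is_cycle_graph G m,
      complete G /\ (vertices G #<= `I_n.+2)%card
    | exists2 H : graph 'rV[R]_n.+1, subgraph H (Gn R n) & isomorphic G H].
Proof.
move=> /ltnW n0 r0 emb.
have [comp|ncomp] := EM (complete G).
  by constructor 3; split=> //; exact: card_complete emb comp.
have diam := embedding_diameter n0 r0 emb.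
have conn x y : vertices G x -> vertices G y -> exists k, path_of_length G x y k.
  by move=> Vx Vy; have [k _ p] := diam _ _ Vx Vy; exists k.
have [x [z [y [xz zy xy nxy]]]] := incomplete_induced_path conn ncomp.
have [] := embedding_midpoint n0 r0 emb xz zy xy nxy.
rewrite le_eqVlt => /orP[/eqP rpi _|rpi _].
  constructor 4; apply: embedding_right_angle emb _ => //.
  by rewrite -rpi invf_div mulrC divfK.
have deg2 := degree_le2 conn (midpoint_degree2 n0 r0 emb rpi) ncomp.
have P2 : exists x y, path_of_length G x y 2.
  by exists x, y; exact: path_of_length2 xz zy xy.
by have [] := path_or_cycle conn diam deg2 P2; [constructor 1|constructor 2].
Qed.
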